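(* $\omega_1$ is the least ordinal admitting no good graph.
   Context: A graph on an ordinal $\gamma$ is a simple undirected graph with vertex set $\gamma$. Such a graph $G$ is good if $G$ has no cycles and, for every $\alpha<\gamma$, the induced subgraph $G|_{[\alpha,\gamma)}$ on the vertex set $[\alpha,\gamma)$ is connected. *)

(* Defs.v *)
From mathcomp Require Import all_boot.
From mathcomp Require Import boolp classical_sets functions cardinality wochoice.

Set Implicit Arguments.
Unset Strict Implicit.
Unset Printing Implicit Defensive.

(* An ordinal is presented as a well-ordered set, with ord_le its reflexive
   order. Ordinals are only meaningful up to order isomorphism, and every notion
   below is invariant under it. *)
Record ord := Ord {
  ord_sort :> eqType;
  ord_le : rel ord_sort;
  ord_wo : well_order ord_le }.

(* a <= b as ordinals: a is isomorphic to an initial segment of b *)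
Definition le_ord (a b : ord) : Prop :=
  exists f : a -> b,
    {mono f : x y / ord_le x y} /\
    (forall x y, ord_le y (f x) -> exists z, f z = y).

Definition least_ord (P : ord -> Prop) (a : ord) : Prop :=
  P a /\ forall b, P b -> le_ord a b.

Record sgraph (V : eqType) := SGraph {
  adj :> rel V;
  adj_sym : symmetric adj;
  adj_irr : irreflexive adj }.

Definition acyclic (V : eqType) (G : sgraph V) : Prop :=
  forall c : seq V, 2 < size c -> ~ ucycle G c.

Definition gconnected (V : eqType) (G : sgraph V) : Prop :=
  forall x y, exists p, path G x p /\ last x p = y.

Section Induced.
Variables (V : eqType) (G : sgraph V) (A : pred V).

Let iadj : rel {x : V | A x} := relpre val G.

Let iadj_sym : symmetric iadj.
Proof. by move=> x y; apply: adj_sym. Qed.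

Let iadj_irr : irreflexive iadj.
Proof. by move=> x; apply: adj_irr. Qed.

Definition induced : sgraph {x : V | A x} := SGraph iadj_sym iadj_irr.
End Induced.

Definition final_segment (g : ord) (a : g) : pred g := fun x => ord_le a x.

Definition good (g : ord) (G : sgraph g) : Prop :=
  acyclic G /\ forall a : g, gconnected (induced G (final_segment a)).

Section OrdTheory.
Variable a : ord.
Implicit Types x y z : a.

Lemma ord_min (P : a -> Prop) : (exists x, P x) ->
  exists x, P x /\ forall y, P y -> ord_le x y.
Proof.
move=> [x Px]; have [|z [[zP zmin] _]] := @ord_wo a (fun x => `[< P x >]).
  by exists x; apply/asboolP.
by exists z; split=> [|y Py]; [apply/asboolP | apply/zmin/asboolP].
Qed.

Lemma ord_le_total x y : ord_le x y \/ ord_le y x.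
Proof.
have [|z [[->|->] zmin]] := @ord_min (fun z => z = x \/ z = y).
- by exists x; left.
- by left; apply: zmin; right.
- by right; apply: zmin; left.
Qed.

Lemma ord_lexx x : ord_le x x.
Proof. by case: (ord_le_total x x). Qed.

Lemma ord_le_anti x y : ord_le x y -> ord_le y x -> x = y.
Proof.
move=> xy yx; have [|z [_ zU]] := @ord_wo a [pred z | (z == x) || (z == y)].
  by exists x; rewrite inE eqxx.
rewrite -(zU x) ?(zU y) //; split; rewrite ?inE ?eqxx ?orbT // => t;
  by rewrite inE => /orP[]/eqP->; rewrite ?ord_lexx.
Qed.

Lemma ord_le_trans y x z : ord_le x y -> ord_le y z -> ord_le x z.
Proof.
move=> xy yz.
have [|t [tP tmin]] := @ord_min (fun t => [\/ t = x, t = y | t = z]).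
  by exists x; constructor 1.
have tx : ord_le t x by apply: tmin; constructor 1.
have ty : ord_le t y by apply: tmin; constructor 2.
have tz : ord_le t z by apply: tmin; constructor 3.
case: tP => E; first by rewrite -E.
- by rewrite (ord_le_anti xy) // -E.
- by rewrite -(ord_le_anti yz) // -E.
Qed.

Lemma ord_nle x y : ~~ ord_le x y -> ord_le y x /\ y <> x.
Proof.
move=> nxy; case: (ord_le_total x y) => [xy|yx]; first by rewrite xy in nxy.
by split=> // E; rewrite E ord_lexx in nxy.
Qed.
End OrdTheory.

Section Comparability.
Variables a b : ord.

Let iso_upto (x : a) (f : a -> b) :=
  (forall u v, ord_le u x -> ord_le v x -> ord_le (f u) (f v) = ord_le u v) /\
  (forall u z, ord_le u x -> ord_le z (f u) -> exists v, ord_le v x /\ f v = z).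

Let iso_upto_le x y f : ord_le y x -> iso_upto x f -> iso_upto y f.
Proof.
move=> yx [fm fi]; split=> [u v uy vy|u z uy zu].
  by apply: fm; apply: (ord_le_trans _ yx).
have ux := ord_le_trans uy yx; have [v [vx vz]] := fi _ _ ux zu.
exists v; split=> //; apply: ord_le_trans uy.
by rewrite -fm // vz.
Qed.

Let iso_upto_uniq x f g : iso_upto x f -> iso_upto x g -> f x = g x.
Proof.
move=> fx gx; apply: contrapT => nfg.
have [|{nfg}u [[ux nfg] umin]] :=
  @ord_min a (fun u => ord_le u x /\ f u <> g u).
  by exists x; rewrite ord_lexx.
have key f' g' : iso_upto x f' -> iso_upto x g' -> f' u <> g' u ->
    (forall v, ord_le v x -> f' v <> g' v -> ord_le u v) ->
    ord_le (f' u) (g' u) -> False.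
  move=> [fm fi] [gm gi] nfg' um fg.
  have [v [vx vE]] := gi _ _ ux fg.
  have vu : ord_le v u by rewrite -gm // vE.
  have [E|/(um _ vx) uv] := pselect (f' v = g' v).
    have uv : ord_le u v by rewrite -fm // E vE ord_lexx.
    by apply: nfg'; rewrite -vE (ord_le_anti uv vu).
  by apply: nfg'; rewrite -vE (ord_le_anti uv vu).
case: (ord_le_total (f u) (g u)).
  by apply: (key f g) => // v vx nv; apply: umin.
by apply: (key g f) => // [/esym//|v vx nv]; apply: umin; split=> // /esym.
Qed.

Lemma le_ord_total : le_ord a b \/ le_ord b a.
Proof.
have [[y0 _]|nb] := pselect (exists y : b, True); last first.
  have no_b (y : b) : False by apply: nb; exists y.
  by right; exists (fun y => False_rect _ (no_b y)); split=> x; case: (no_b x).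
pose D x := exists f, iso_upto x f.
have /choice[h hP] x : exists f, D x -> iso_upto x f.
  by have [[f fx]|nD] := pselect (D x); [exists f | exists (fun=> y0)].
pose F x := h x x.
have Ddown x y : ord_le y x -> D x -> D y.
  by move=> yx [f fx]; exists f; apply: iso_upto_le fx.
have Fh x u : D x -> ord_le u x -> F u = h x u.
  move=> Dx ux; apply: (@iso_upto_uniq u (h u) (h x)); first exact: hP (Ddown _ _ ux Dx).
  by apply: iso_upto_le ux _; apply: hP.
have Fm u v : D u -> D v -> ord_le (F u) (F v) = ord_le u v.
  move=> Du Dv; case: (ord_le_total u v) => uv.
    by rewrite (Fh v u) // (hP _ Dv).1 ?ord_lexx.
  by rewrite (Fh u v) // (hP _ Du).1 ?ord_lexx.
have Fi u z : D u -> ord_le z (F u) -> exists v, D v /\ F v = z.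
  move=> Du zu; have [v [vu vz]] := (hP _ Du).2 _ _ (ord_lexx u) zu.
  by exists v; split; [apply: Ddown Du | rewrite (Fh u)].
have [allD|nD] := pselect (forall x, D x).
  left; exists F; split=> [u v|u z zu]; first exact: Fm.
  by have [v [_ vz]] := Fi _ _ (allD u) zu; exists v.
have [|x0 [nDx0 x0min]] := @ord_min a (fun x => ~ D x).
  by apply: contrapT => nex; apply: nD => x; apply: contrapT => nDx;
     apply: nex; exists x.
have Dlt u : D u <-> ord_le u x0 /\ u <> x0.
  split=> [Du|[ux0 nux0]].
    split=> [|E]; last by rewrite -E in nDx0.
    by case: (ord_le_total u x0) => // /Ddown/(_ Du).
  by apply: contrapT => /x0min x0u; apply: nux0; apply: ord_le_anti.
have [Fsurj|nFsurj] := pselect (forall y, exists v, D v /\ F v = y).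
  have [G GP] := choice Fsurj.
  right; exists G; split=> [y z|y x xy].
    by rewrite -Fm; [rewrite (GP y).2 (GP z).2 | case: (GP y) | case: (GP z)].
  have Dx : D x by apply: Ddown xy (GP y).1.
  exists (F x); have [DG FG] := GP (F x).
  by apply: ord_le_anti; rewrite -Fm // FG ord_lexx.
exfalso.
have [|y1 [ny1 y1min]] := @ord_min b (fun y => ~ exists v, D v /\ F v = y).
  by apply: contrapT => nex; apply: nFsurj => y; apply: contrapT => nDy;
     apply: nex; exists y.
have y1F u : D u -> ord_le y1 (F u) = false.
  by move=> Du; apply/negP => /(Fi _ _ Du).
have Fy1 u : D u -> ord_le (F u) y1.
  by move=> /y1F; case: (ord_le_total y1 (F u)) => [->|].
apply: nDx0; exists (fun u => if u == x0 then y1 else F u).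
split=> [u v ux vx|u z ux].
  case: eqP => [->|nu]; case: eqP => [->|nv]; rewrite ?ord_lexx //.
  - rewrite y1F; last by apply/Dlt.
    by apply/esym/negP => xv; apply: nv; apply: ord_le_anti.
  - by rewrite Fy1 ?ux //; apply/Dlt.
  - by apply: Fm; apply/Dlt.
have inF t : (exists v, D v /\ F v = t) ->
    exists v, ord_le v x0 /\ (if v == x0 then y1 else F v) = t.
  by move=> [v [/Dlt[vx /eqP/negPf nv] vt]]; exists v; rewrite nv.
case: eqP => [_ zy1|nu zu]; last by apply: inF; apply: (Fi u) => //; apply/Dlt.
have [->|nz] := eqVneq z y1; first by exists x0; rewrite ord_lexx eqxx.
apply: inF; apply: contrapT => /y1min y1z.
by move/eqP: nz; apply; apply: ord_le_anti.
Qed.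
End Comparability.

Lemma sub_ord_wo (a : ord) (A : pred a) :
  well_order (relpre val (@ord_le a) : rel {x : a | A x}).
Proof.
apply: antisymmetric_well_order => [x y /andP[xy yx]|P [x Px]].
  by apply: val_inj; apply: ord_le_anti.
have [|_ [[z Pz <-] zmin]] :=
  @ord_min a (fun t => exists2 u : {x : a | A x}, u \in P & val u = t).
  by exists (val x), x.
by exists z; split=> // y Py; apply: zmin; exists y.
Qed.

Definition sub_ord (a : ord) (A : pred a) : ord := Ord (@sub_ord_wo a A).

Definition uncountable_ord (a : ord) : Prop := ~ countable [set: a].

Lemma omega1_exists : exists w : ord, least_ord uncountable_ord w.
Proof.
suff [w wunc wseg] : exists2 w : ord, uncountable_ord w &
    forall x : w, countable [set y | ord_le y x /\ y <> x].
  exists w; split=> // b bunc.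
  case: (le_ord_total w b) => // -[f [fm fi]].
  have finj : injective f.
    by move=> x y E; apply: ord_le_anti; rewrite -fm E ord_lexx.
  have [/choice[g gP]|nsurj] := pselect (forall y, exists x, f x = y).
    exists g; split=> [x y|x y _]; first by rewrite -fm !gP.
    by exists (f y); apply: finj; rewrite gP.
  exfalso; apply: bunc.
  have [y ny] : exists y, ~ exists x, f x = y.
    by apply: contrapT => nex; apply: nsurj => y; apply: contrapT => nx;
       apply: nex; exists y.
  have /countable_injP[h hinj] := wseg y.
  apply/countable_injP; exists (h \o f) => u v _ _ /hinj E; apply: finj.
  have lty x : ord_le (f x) y /\ f x <> y.
    split=> [|E']; last by apply: ny; exists x.
    by case: (ord_le_total (f x) y) => // /fi.
  by apply: E; rewrite inE; apply: lty.
have [R Rwo] := well_ordering_principle (nat -> bool : eqType).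
pose w := Ord Rwo.
have wunc : uncountable_ord w.
  move=> /countable_injP[h hinj].
  pose d n := `[< exists2 f : nat -> bool, h f = n & f n = false >].
  have : d (h d) <-> d (h d) = false.
    split=> [/asboolP[f E]|E]; last by apply/asboolP; exists d.
    by rewrite (hinj f d) ?in_setT // => <-.
  by case: (d (h d)) => -[]; [move=> /(_ isT) | move=> _ /(_ erefl)].
have [wseg|nseg] :=
  pselect (forall x : w, countable [set y | ord_le y x /\ y <> x]).
  by exists w.
have [|x [xunc xmin]] :=
  @ord_min w (fun x => ~ countable [set y | ord_le y x /\ y <> x]).
  by apply: contrapT => nex; apply: nseg => y; apply: contrapT => nx;
     apply: nex; exists y.
pose A (y : w) := ord_le y x && (y != x).
exists (sub_ord A).
  move=> /countable_injP[h hinj]; apply: xunc; apply/countable_injP.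
  exists (fun y => oapp h 0 (insub y)) => u v.
  rewrite !inE /= => -[ux /eqP nux] [vx /eqP nvx].
  have uP : A u by apply/andP.
  have vP : A v by apply/andP.
  rewrite (insubT A uP) (insubT A vP) /= => E.
  by have [] := hinj _ _ (in_setT _) (in_setT _) E.
move=> [y Ay]; have /andP[yx nyx] := Ay.
have /countable_injP[h hinj] : countable [set z : w | ord_le z y /\ z <> y].
  apply: contrapT => /xmin xy; move/eqP: nyx; apply.
  exact: ord_le_anti.
apply/countable_injP; exists (h \o val) => u v.
rewrite !inE /= => -[uy nu] [vy nv] /hinj E; apply: val_inj; apply: E; rewrite inE.
  by split=> // E; apply: nu; apply: val_inj.
by split=> // E; apply: nv; apply: val_inj.
Qed.

(* The first uncountable ordinal; it is determined up to isomorphism by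
   omega1P, so the choice of representative is immaterial. *)
Definition omega1 : ord := sval (cid omega1_exists).

Lemma omega1P : least_ord uncountable_ord omega1.
Proof. exact: svalP (cid omega1_exists). Qed.

(* Main.v *)
From mathcomp Require Import all_boot zify.
From mathcomp Require Import boolp classical_sets functions cardinality.
Require Import Defs.

Set Implicit Arguments.
Unset Strict Implicit.
Unset Printing Implicit Defensive.

(** In a good graph every vertex has at most one larger neighbour: two of them
    could be joined above the vertex, which would close a cycle. On an ordinal
    without maximum the graph is thus given by a map [p] with [x < p x], and
    connectedness makes any two [p]-orbits meet. In [omega1] the orbit of a
    vertex is countable, hence bounded by some [d], and the orbit of [d] stays
    above it. Conversely, for an injection [e] of an ordinal into [nat], let
    [p x] be the [e]-least element above [x]. Then [e] increases along orbits,
    while [p x <= y] forces [e (p x) <= e y]; so the orbit of [x < y] jumps over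
    [y] after finitely many steps, and the first jump lands on [p y] unless [y]
    was met before. *)

(** * Strict order on an ordinal *)

Definition ord_lt (a : ord) (x y : a) : bool := ~~ ord_le y x.

Section OrdLt.
Variable a : ord.
Implicit Types x y z : a.

Lemma ord_ltW x y : ord_lt x y -> ord_le x y.
Proof. by case/ord_nle. Qed.

Lemma ord_lt_neqAle x y : ord_lt x y = (x != y) && ord_le x y.
Proof.
apply/idP/andP => [/ord_nle[xy /eqP] //|[nxy xy]].
by apply/negP => yx; rewrite (ord_le_anti xy yx) eqxx in nxy.
Qed.

Lemma ord_ltxx x : ord_lt x x = false.
Proof. by rewrite /ord_lt ord_lexx. Qed.

Lemma ord_le_lt_trans y x z : ord_le x y -> ord_lt y z -> ord_lt x z.
Proof. by move=> xy; apply: contra => /ord_le_trans; apply. Qed.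

Lemma ord_lt_le_trans y x z : ord_lt x y -> ord_le y z -> ord_lt x z.
Proof. by move=> xy yz; apply: contra xy; apply: ord_le_trans. Qed.

Lemma ord_nlt x y : ~~ ord_lt x y -> ord_le y x.
Proof. by move/negPn. Qed.

(** If [z] were least with [f z] below [z], then [f (f z)] would be below [f z], making [f z] a
    smaller example. *)
Lemma ord_mono_ge (f : a -> a) :
  {mono f : x y / ord_le x y} -> forall x, ord_le x (f x).
Proof.
move=> fm x; apply: contrapT => /negP nx.
have [|z [zf zmin]] := @ord_min a (fun z => ord_lt (f z) z); first by exists x.
by have := zmin (f z); rewrite /ord_lt fm => /(_ zf); apply/negP.
Qed.
End OrdLt.

(** * Good graphs and larger neighbours *)

Lemma induced_connectedP (V : eqType) (G : sgraph V) (A : pred V) :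
  gconnected (induced G A) <->
  forall x y, A x -> A y -> exists p, [/\ path G x p, all A p & last x p = y].
Proof.
split=> [conn x y Ax Ay|conn [x Ax] [y Ay]].
  have [p [pp pl]] := conn (exist _ x Ax) (exist _ y Ay).
  exists (map val p); split.
  - by rewrite -[x]/(val (exist A x Ax)) path_map.
  - by apply/allP => _ /mapP[u _ ->]; apply: valP.
  - by rewrite -[x]/(val (exist A x Ax)) last_map pl.
have [p [pp Ap pl]] := conn x y Ax Ay.
have [q pq] := all_sigP Ap; exists q; split.
  by rewrite pq -[x]/(val (exist A x Ax)) path_map in pp.
by apply: val_inj; rewrite /= -pl pq -[x in RHS]/(val (exist A x Ax)) last_map.
Qed.

Definition forward_unique (g : ord) (G : sgraph g) : Prop :=
  forall x u v : g, G x u -> G x v -> ord_lt x u -> ord_lt x v -> u = v.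

(** The least vertex of a cycle has two distinct larger neighbours on it. *)
Lemma forward_unique_acyclic (g : ord) (G : sgraph g) :
  forward_unique G -> acyclic G.
Proof.
move=> fu c c2 /andP[cc uc].
have [|m [mc mmin]] := @ord_min g (fun x => x \in c).
  by case: c c2 {cc uc} => // x c _; exists x; rewrite mem_head.
have [i c' c'E] := rot_to mc.
have c'ge x : x \in c' -> ord_le m x.
  by move=> xc'; apply: mmin; rewrite -(mem_rot i) c'E inE xc' orbT.
move: c2 cc uc; rewrite -(size_rot i) -(rot_cycle i) -(rot_uniq i) c'E.
case/lastP: c' c'ge {c'E} => // s v; case: s => // u s c'ge _.
rewrite /= !rcons_path last_rcons => /and3P[mu _ vm].
rewrite inE mem_rcons inE !negb_or => /and3P[/and3P[nmu nmv _] nuv _].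
have E : u = v.
  apply: (fu m) => //; first by rewrite adj_sym.
    by rewrite ord_lt_neqAle nmu c'ge // mem_head.
  by rewrite ord_lt_neqAle nmv c'ge // inE mem_rcons mem_head orbT.
by rewrite E mem_rcons mem_head in nuv.
Qed.

Lemma good_forward_unique (g : ord) (G : sgraph g) :
  good G -> forward_unique G.
Proof.
move=> [acyc conn] x u v xu xv ltu ltv; apply/eqP/negP => /negP nuv.
(* [s] is the successor of [x], so a path from [u] to [v] in the final segment of [s] avoids [x]. *)
have [|s [xs smin]] := @ord_min g (fun z => ord_lt x z); first by exists u.
have [p [pp sp pl]] :=
  (induced_connectedP G (final_segment s)).1 (conn s) u v (smin _ ltu) (smin _ ltv).
case/shortenP: pp pl => q qp qu qs ql.
have xq z : z \in q -> ord_lt x z.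
  by move=> /qs/(allP sp)/(ord_lt_le_trans xs).
apply: (acyc (x :: u :: q)).
  by case: q ql {qp qu qs xq} => //= E; rewrite E eqxx in nuv.
apply/andP; split; first by rewrite /= xu rcons_path qp ql adj_sym.
rewrite cons_uniq qu andbT inE negb_or.
by apply/andP; split; [case/ord_nle: ltu => _ /eqP | apply/negP => /xq; rewrite ord_ltxx].
Qed.

(** * Good graphs on countable ordinals *)

Section CountableGood.
Variables (g : ord) (e : g -> nat) (p : g -> g).
Hypothesis e_inj : injective e.
(* Nothing is required of [p] at a maximal element. *)
Hypothesis p_min : forall x y, ord_lt x y ->
  ord_lt x (p x) /\ forall z, ord_lt x z -> e (p x) <= e z.

(** The strict inequalities discard the arbitrary value of [p] at a maximum. *)
Let padj : rel g := fun x y =>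
  ord_lt x y && (y == p x) || ord_lt y x && (x == p y).

Let padj_sym : symmetric padj.
Proof. by move=> x y; rewrite /padj orbC. Qed.

Let padj_irr : irreflexive padj.
Proof. by move=> x; rewrite /padj ord_ltxx. Qed.

Let G : sgraph g := SGraph padj_sym padj_irr.

Let G_forward_unique : forward_unique G.
Proof.
have key x u : G x u -> ord_lt x u -> u = p x.
  move=> /orP[/andP[_ /eqP] //|/andP[ux _] xu].
  by have := ord_lt_le_trans ux (ord_ltW xu); rewrite ord_ltxx.
by move=> x u v xu xv ltu ltv; rewrite (key x u) // (key x v).
Qed.

Let G_edge x y : ord_lt x y -> padj x (p x).
Proof. by move=> /p_min[xp _]; rewrite /padj xp eqxx. Qed.

Let joined x y := exists s, [/\ path G x s, all (ord_le x) s & last x s = y].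

(** [n] bounds the gap between [e (p x)] and [e y], which shrinks when [x] is replaced by [p x]; for
    [n = 0] the bound contradicts the minimality of [p x] unless [x = y]. *)
Let up_joined n x y : ord_le x y -> e y < n + e (p x) -> joined x y.
Proof.
elim: n x => [|n IHn] x xy ltn; (have [->|nxy] := eqVneq x y; first by exists [::]);
  have ltxy : ord_lt x y by [rewrite ord_lt_neqAle nxy];
  have [xpx pxmin] := p_min ltxy.
  by have := pxmin _ ltxy; lia.
have [ypx|/ord_nlt pxy] := boolP (ord_lt y (p x)).
  (* The orbit jumps over [y]: [p x] is a candidate for [p y] and conversely, so they coincide and
     join [x] to [y]. *)
  have [ypy pymin] := p_min ypx.
  have pxy : p x = p y.
    apply: e_inj; apply/eqP; rewrite eqn_leq pymin // pxmin //.
    exact: ord_le_lt_trans ypy.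
  exists [:: p x; y]; split=> //=; last by rewrite ord_ltW ?xy.
  by rewrite (G_edge ltxy) padj_sym pxy (G_edge ypy).
have [E|npxy] := eqVneq (p x) y.
  by exists [:: p x]; split=> //=; rewrite ?(G_edge ltxy) // ord_ltW.
have ltpxy : ord_lt (p x) y by rewrite ord_lt_neqAle npxy.
have [pp ppmin] := p_min ltpxy.
(* [p (p x)] also lies above [x], so [e] cannot decrease; injectivity makes the increase strict. *)
have ltpp : e (p x) < e (p (p x)).
  rewrite ltn_neqAle pxmin ?andbT; last exact: ord_le_lt_trans (ord_ltW xpx) pp.
  by apply/negP => /eqP/e_inj E; rewrite -E ord_ltxx in pp.
have [|s [sp sx sl]] := IHn (p x) pxy; first by lia.
exists (p x :: s); split=> //=; first by rewrite (G_edge ltxy).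
rewrite (ord_ltW xpx); apply/allP => z /(allP sx).
exact: ord_le_trans (ord_ltW xpx).
Qed.

Let up_path x y : ord_le x y -> joined x y.
Proof. by move=> xy; apply: (@up_joined (e y).+1) => //; rewrite addSn ltnS leq_addr. Qed.

Lemma eleast_good : exists G : sgraph g, good G.
Proof.
exists G; split=> [|a]; first exact: forward_unique_acyclic.
apply/induced_connectedP => x y ax ay.
have down u v : ord_le a u -> ord_le u v -> exists s,
    [/\ path G u s, all (ord_le a) s & last u s = v].
  move=> au /up_path[s [sp su sl]]; exists s; split=> //.
  by apply/allP => z /(allP su); apply: ord_le_trans au.
have [xy|yx] := ord_le_total x y; first exact: down.
have [s [sp sa sl]] := down _ _ ay yx.
(* The ascending path from [y] to [x], traversed backwards without its starting point [x]. *)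
exists (rev (belast y s)); split.
- rewrite -sl rev_path; apply: sub_path sp => u v.
  by rewrite /= padj_sym.
- apply/allP => z; rewrite mem_rev => /mem_belast.
  by rewrite inE => /orP[/eqP->//|/(allP sa)].
- by case: s sl {sp sa} => //= z s _; rewrite rev_cons last_rcons.
Qed.
End CountableGood.

Lemma countable_good (g : ord) :
  countable [set: g] -> exists G : sgraph g, good G.
Proof.
move=> /countable_injP[e einj].
have /choice[p pP] (x : g) : exists z, forall y, ord_lt x y ->
    ord_lt x z /\ forall t, ord_lt x t -> e z <= e t.
  have [[y xy]|nx] := pselect (exists y, ord_lt x y); last first.
    by exists x => y xy; case: nx; exists y.
  have exn : exists n, `[< exists2 z, ord_lt x z & e z = n >].
    by exists (e y); apply/asboolP; exists y.
  case: (ex_minnP exn) => n /asboolP[z xz ez] nmin.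
  exists z => _ _; split=> // t xt; rewrite ez; apply: nmin.
  by apply/asboolP; exists t.
apply: (@eleast_good g e p) => // x y E.
by apply: einj; rewrite ?in_setT.
Qed.

(** * No good graph on the first uncountable ordinal *)

Lemma omega1_segment_countable (x : omega1) : countable [set y | ord_lt y x].
Proof.
apply: contrapT => xunc; pose A (y : omega1) := ord_lt y x.
(* Otherwise minimality embeds [omega1] into the segment below [x], and [x] is sent below itself,
   against [ord_mono_ge]. *)
have [|f [fm _]] := omega1P.2 (sub_ord A).
  move=> /countable_injP[h hinj]; apply: xunc; apply/countable_injP.
  exists (fun y => oapp h 0 (insub y)) => u v; rewrite !inE /= => uP vP.
  rewrite (insubT A uP) (insubT A vP) /= => E.
  by have [] := hinj _ _ (in_setT _) (in_setT _) E.
have /ord_mono_ge/(_ x) : {mono (fun y => val (f y)) : y z / ord_le y z}.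
  by move=> y z; rewrite -[RHS]fm.
by apply/negP; apply: (valP (f x)).
Qed.

(** If no bound exists, the closed segments up to the [s n] cover [omega1]. The boolean splits each
    into its endpoint and a countable open segment. *)
Lemma omega1_bounded (s : nat -> omega1) : exists d, forall n, ord_lt (s n) d.
Proof.
apply: contrapT => nd; apply: omega1P.1.
have -> : [set: omega1]%classic =
    (\bigcup_(i in [set: nat * bool])
       if i.2 then [set s i.1] else [set y | ord_lt y (s i.1)])%classic.
  apply/seteqP; split=> // d _; apply: contrapT => nds; apply: nd; exists d => n.
  apply/negP => dn; apply: nds; exists (n, d == s n) => //=.
  by case: eqVneq => [//|ndn]; rewrite /= ord_lt_neqAle ndn.
apply: bigcup_countable; first exact: countableP.
move=> [n []] _; [exact: countable1 | exact: omega1_segment_countable].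
Qed.

Lemma omega1_not_good (G : sgraph omega1) : ~ good G.
Proof.
move=> gG; have fu := good_forward_unique gG; have [_ conn] := gG.
have /choice[p pP] (x : omega1) : exists y, G x y /\ ord_lt x y.
  (* A path to some [d] above [x] inside the final segment of [x] must begin with an edge to a
     larger vertex. *)
  have [d /(_ 0) xd] := omega1_bounded (fun=> x).
  have [[|y q] []] := (induced_connectedP _ _).1 (conn x) x d (ord_lexx x) (ord_ltW xd).
    by move=> _ _ E; rewrite -E ord_ltxx in xd.
  move=> /= /andP[xy _] /andP[lexy _] _; exists y; split=> //.
  rewrite ord_lt_neqAle [ord_le _ _]lexy andbT.
  by apply/negP => /eqP E; rewrite E adj_irr in xy.
have [x0 _] : exists x : omega1, True.
  apply: contrapT => nx; apply: omega1P.1.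
  suff -> : ([set: omega1] = set0)%classic by exact: countable0.
  by apply/seteqP; split=> // x _; case: nx; exists x.
have p_uniq x y : G x y -> ord_lt x y -> y = p x.
  by move=> xy lt; apply: (fu x) => //; case: (pP x).
have [d dP] := omega1_bounded (fun n => iter n p x0).
pose meets y := exists m n, iter m p y = iter n p x0.
have meets_adj x y : G x y -> meets x -> meets y.
  move=> xy [m [n mn]].
  (* An edge means [y = p x] or [x = p y], so one extra iterate on one side suffices. *)
  have [lt|/ord_nlt le] := boolP (ord_lt x y).
    by exists m, n.+1; rewrite (p_uniq x y) // -iterSr /= mn.
  exists m.+1, n; rewrite iterSr -(p_uniq y x) ?[G y x]adj_sym // ord_lt_neqAle le andbT.
  by apply/negP => /eqP E; rewrite E adj_irr in xy.
have [q [qp _ ql]] :=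
  (induced_connectedP _ _).1 (conn x0) x0 d (ord_lexx x0) (ord_ltW (dP 0)).
have meets_last x : path G x q -> meets x -> meets (last x q).
  by elim: q x {qp ql} => //= y q IHq x /andP[xy yq] /(meets_adj _ _ xy); apply: IHq.
have [|m [n mn]] := meets_last x0 qp; first by exists 0, 0.
have orbit_ge y k : ord_le y (iter k p y).
  elim: k => [|k IHk]; first exact: ord_lexx.
  exact: ord_le_trans IHk (ord_ltW (pP _).2).
by have := dP n; rewrite -mn ql; apply/negP/negPn/orbit_ge.
Qed.

Theorem theorem3p3 :
  least_ord (fun g : ord => ~ exists G : sgraph g, good G) omega1.
Proof.
split=> [[G]|g ng]; first exact: omega1_not_good.
by apply: omega1P.2 => /countable_good.
Qed.
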